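(* Let $G$ be a finite, simple, undirected, connected graph on $n\geq 4$ vertices that contains no triangle $K_3$ (as an induced subgraph) and has no pair of false-twin vertices. Then $G$ has at least $\lceil \frac{n}{2} \rceil$ bicliques.
   Context: All graphs are finite, simple, undirected and connected (standing assumption of the paper). A biclique of $G$ is a maximal (with respect to vertex-set inclusion) induced subgraph of $G$ that is a complete bipartite graph $K_{p,q}$ with $p,q\geq 1$; bicliques are counted as distinct vertex sets. Two distinct vertices $u,v$ are false-twins if $N(u)=N(v)$, where $N(\cdot)$ denotes the open neighborhood. *)

(* Defs.v *)
From mathcomp Require Import all_boot.
Set Implicit Arguments.
Unset Strict Implicit.
Unset Printing Implicit Defensive.

(* A finite simple undirected graph is a symmetric irreflexive relation
   [e : rel T] on a finType [T] of vertices. *)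

Definition nbh (T : finType) (e : rel T) (x : T) : {set T} := [set y | e x y].

Definition connected_graph (T : finType) (e : rel T) : Prop :=
  forall x y : T, connect e x y.

(* Irreflexivity of [e] forces the three vertices to be distinct. *)
Definition triangle_free (T : finType) (e : rel T) : Prop :=
  forall x y z : T, ~~ [&& e x y, e y z & e x z].

Definition false_twins (T : finType) (e : rel T) (x y : T) : bool :=
  (x != y) && (nbh e x == nbh e y).

(* The subgraph of [e] induced by [S] is a K_{p,q} with p, q >= 1. *)
Definition induces_complete_bipartite (T : finType) (e : rel T) (S : {set T})
    : bool :=
  [exists A : {set T}, exists B : {set T},
    [&& A != set0, B != set0, [disjoint A & B], A :|: B == S
      & [forall x in S, forall y in S,
          e x y == ((x \in A) && (y \in B)) || ((x \in B) && (y \in A))]]].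

Definition bicliques (T : finType) (e : rel T) : {set {set T}} :=
  [set S | maxset (induces_complete_bipartite e) S].

(* Main.v *)
Require Import Defs.
From mathcomp Require Import all_boot.

Set Implicit Arguments.
Unset Strict Implicit.
Unset Printing Implicit Defensive.

(** Without triangles, a vertex [v] spans the biclique with sides [N(v)] and
    [{w | N(v) \subset N(w)}].  The sides of a biclique are determined by its
    vertex set, and in a twin-free graph each side is [N(v)] for at most one
    [v], so every biclique is spanned by at most two of the [n] vertices. *)

Section TriangleFree.
Variables (T : finType) (e : rel T).
Hypotheses (e_sym : symmetric e) (e_irr : irreflexive e).
Hypothesis e_K3free : triangle_free e.
Implicit Types (u v w x y : T) (S : {set T}).

(** These are the common neighbours of all vertices in [nbh e v]. *)
Definition dominators v : {set T} := [set w | nbh e v \subset nbh e w].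
Definition span_biclique v := nbh e v :|: dominators v.

Lemma in_nbh x y : (y \in nbh e x) = e x y.
Proof. by rewrite inE. Qed.

Lemma dominators_refl v : v \in dominators v.
Proof. by rewrite inE. Qed.

Lemma span_biclique_refl v : v \in span_biclique v.
Proof. by rewrite inE dominators_refl orbT. Qed.

Lemma triangleF x y z : e x y -> e y z -> e x z -> False.
Proof. by move=> xy yz xz; move: (e_K3free x y z); rewrite xy yz xz. Qed.

Lemma dominator_edge v w x : w \in dominators v -> e v x -> e w x.
Proof. by rewrite inE => /subsetP sub vx; rewrite -in_nbh sub ?in_nbh. Qed.

Lemma nbh_not_dominator v w : w \in dominators v -> w \notin nbh e v.
Proof.
move=> vw; rewrite in_nbh; apply/negP => ew.
by have := dominator_edge vw ew; rewrite e_irr.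
Qed.

(** Two adjacent dominators would close a triangle with any neighbour of [v], which is why [v] must
    have one. Together with the next lemma this recovers the sides from the vertex set alone. *)
Lemma span_biclique_nbhI_dominator v x : nbh e v != set0 ->
  x \in dominators v -> span_biclique v :&: nbh e x = nbh e v.
Proof.
case/set0Pn=> z; rewrite in_nbh => vz xC.
apply/setP => y; rewrite in_setI in_setU !in_nbh.
apply/andP/idP => [[/orP[//|yC] xy]|vy].
  case: (triangleF xy (dominator_edge yC vz)).
  exact: dominator_edge xC vz.
by rewrite vy; split=> //; apply: dominator_edge xC vy.
Qed.

(** Two adjacent neighbours of [v] would form a triangle with [v]. *)
Lemma span_biclique_nbhI_nbh v x :
  x \in nbh e v -> span_biclique v :&: nbh e x = dominators v.
Proof.
rewrite in_nbh => vx; apply/setP => y; rewrite in_setI in_setU !in_nbh.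
apply/andP/idP => [[/orP[vy|//] xy]|yC].
  by case: (triangleF vx xy vy).
by rewrite yC orbT; split=> //; rewrite e_sym; apply: dominator_edge yC vx.
Qed.

Lemma span_biclique_complete v : nbh e v != set0 ->
  induces_complete_bipartite e (span_biclique v).
Proof.
move=> N0; apply/existsP; exists (nbh e v); apply/existsP; exists (dominators v).
apply/and5P; split=> //.
- by apply/set0Pn; exists v; apply: dominators_refl.
- rewrite disjoint_sym disjoint_subset; apply/subsetP => w /nbh_not_dominator.
  by rewrite !inE.
- apply/forall_inP => x xS; apply/forall_inP => y yS; apply/eqP.
  (* Adjacency inside the span is membership in the trace of [nbh e x], which the two preceding
     lemmas compute. *)
  have exy : e x y = (y \in span_biclique v :&: nbh e x).
    by rewrite in_setI yS in_nbh.
  move: xS; rewrite exy in_setU; case xN: (x \in nbh e v) => /= xC.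
    rewrite (span_biclique_nbhI_nbh xN).
    case xC': (x \in dominators v); last by rewrite orbF.
    by have := nbh_not_dominator xC'; rewrite xN.
  by rewrite span_biclique_nbhI_dominator // xC.
Qed.

(** Let [A] be the side of [S] containing [v]. All of [B] is adjacent to [v], and [B] contains
    [nbh e v] since [S] does; so each vertex of [A] is adjacent to all of [nbh e v], that is,
    dominates [v]. *)
Lemma span_biclique_maximal v S : induces_complete_bipartite e S ->
  span_biclique v \subset S -> S \subset span_biclique v.
Proof.
move=> /existsP[A /existsP[B /and5P[_ _ dAB /eqP defS eS]]] sub.
have {}eS x y : x \in S -> y \in S ->
    e x y = ((x \in A) && (y \in B)) || ((x \in B) && (y \in A)).
  by move=> xS yS; apply/eqP; move: eS => /forall_inP/(_ x xS)/forall_inP/(_ y yS).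
have vS : v \in S by apply: (subsetP sub); apply: span_biclique_refl.
wlog vA : A B dAB defS eS / v \in A => [gen|].
  have /orP[vA|vB] : (v \in A) || (v \in B) by rewrite -in_setU defS.
    exact: (gen A B).
  apply: (gen B A) => //; rewrite 1?disjoint_sym // 1?setUC // => x y xS yS.
  by rewrite eS // orbC.
have vNB : v \in B = false by apply: disjointFr dAB vA.
have evS x : x \in S -> e v x = (x \in B).
  by move=> xS; rewrite eS // vA vNB orbF.
apply/subsetP => x xS; rewrite in_setU in_nbh evS //.
have /orP[xA|->//] : (x \in A) || (x \in B) by rewrite -in_setU defS.
apply/orP; right; rewrite inE; apply/subsetP => y; rewrite !in_nbh => vy.
have yS : y \in S by apply: (subsetP sub); rewrite in_setU in_nbh vy.
by rewrite eS // xA -evS // vy.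
Qed.

Lemma span_biclique_bicliques v :
  nbh e v != set0 -> span_biclique v \in bicliques e.
Proof.
move=> N0; rewrite inE; apply/maxsetP; split.
  exact: span_biclique_complete.
move=> S cS sub; apply/eqP; rewrite eqEsubset sub andbT.
exact: span_biclique_maximal.
Qed.

Hypothesis nbh_neq0 : forall v, nbh e v != set0.
Hypothesis e_twinfree : forall x y, ~~ false_twins e x y.

Lemma nbh_inj : injective (nbh e).
Proof.
move=> x y /eqP eN; apply/eqP; move: (e_twinfree x y).
by rewrite /false_twins eN andbT negbK.
Qed.

(** The trace of [nbh e u] on the common span is [nbh e u] itself. If [u] dominated [v], that trace
    would also be [nbh e v], making [u] and [v] false twins; so [u] lies on the other side. *)
Lemma span_biclique_eq u v : span_biclique u = span_biclique v ->
  u != v -> nbh e u = dominators v.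
Proof.
move=> eS uv; have := span_biclique_refl u; rewrite eS in_setU => /orP[uN|uC].
  rewrite -(span_biclique_nbhI_nbh uN) -eS.
  by rewrite span_biclique_nbhI_dominator ?dominators_refl.
case/eqP: uv; apply: nbh_inj.
rewrite -(span_biclique_nbhI_dominator (nbh_neq0 v) uC) -eS.
by rewrite span_biclique_nbhI_dominator ?dominators_refl.
Qed.

(** Once one [v] in the fiber is fixed, every other member has neighbourhood [dominators v], so
    there is at most one by [nbh_inj]. *)
Lemma card_span_biclique_fiber S : #|[set v | span_biclique v == S]| <= 2.
Proof.
case: (set_0Vmem [set v | span_biclique v == S]) => [->|[v vF]].
  by rewrite cards0.
rewrite (cardsD1 v) vF ltnS; move: vF; rewrite inE => /eqP eS.
apply/card_le1_eqP => x y; rewrite !inE.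
move=> /andP[xv /eqP xS] /andP[yv /eqP yS]; apply: nbh_inj.
by rewrite (@span_biclique_eq x v) ?xS ?eS // (@span_biclique_eq y v) ?yS ?eS.
Qed.

Lemma card_leq_double_bicliques : #|T| <= #|bicliques e|.*2.
Proof.
(* Vertices are counted by the biclique they span. *)
rewrite -[leqLHS]sum1_card (partition_big span_biclique [in bicliques e]) /=; last first.
  by move=> v _; apply: span_biclique_bicliques.
rewrite -muln2 -sum_nat_const; apply: leq_sum => S _.
by rewrite sum1dep_card; apply: card_span_biclique_fiber.
Qed.

End TriangleFree.

(** A path from [v] to a second vertex starts with an edge at [v]. *)
Lemma connected_nbh_neq0 (T : finType) (e : rel T) (v : T) :
  connected_graph e -> 1 < #|T| -> nbh e v != set0.
Proof.
move=> e_conn; rewrite (cardD1 v) inE ltnS => /card_gt0P[y].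
rewrite !inE andbT => yv; have /connectP[[|z p] /=] := e_conn v y.
  by move=> _ eyv; rewrite eyv eqxx in yv.
by case/andP=> vz _ _; apply/set0Pn; exists z; rewrite inE.
Qed.

Theorem theorem4p5 (T : finType) (e : rel T)
    (e_sym : symmetric e) (e_irr : irreflexive e)
    (e_conn : connected_graph e)
    (n_ge4 : 4 <= #|T|)
    (e_K3free : triangle_free e)
    (e_twinfree : forall x y : T, ~~ false_twins e x y) :
  uphalf #|T| <= #|bicliques e|.
Proof.
rewrite leq_uphalf_double; apply: card_leq_double_bicliques => // v.
by apply: connected_nbh_neq0 => //; apply: leq_trans n_ge4.
Qed.
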